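(* Let $r\ge 2$ be a prime and $G$ a finite group with $s$ conjugacy classes, exactly $d$ of which are not $r$-th powers in $G$. Then the number $\mathcal{CC}_r(G\wr S_n)$ of conjugacy classes of $G\wr S_n$ consisting of $r$-th powers is $$\mathcal{CC}_r(G\wr S_n)=\sum_{(n_1,\dots,n_s)}p_r(n_1)\cdots p_r(n_d)\,p_r'(n_{d+1})\cdots p_r'(n_s),$$ where the sum runs over all ordered $s$-tuples $(n_1,\dots,n_s)$ of integers $n_i\ge 0$ with $\sum_{i=1}^s n_i=n$.
   Context: $G\wr S_n$ is the set of pairs $(f,\pi)$ with $f:\{1,\dots,n\}\to G$ and $\pi\in S_n$, with product $(f,\pi)(f',\pi')=(ff'_\pi,\pi\pi')$, $f'_\pi(i)=f'(\pi^{-1}(i))$, pointwise product of functions. A conjugacy class of a group is an $r$-th power if all its elements are $r$-th powers in that group. For a partition $\lambda=1^{m_1}2^{m_2}\cdots$ of $n$ ($m_i$ = number of parts equal to $i$): $p_r(n)$ is the number of partitions of $n$ with $r\mid m_i$ for every $i\ge1$, and $p_r'(n)$ is the number of partitions of $n$ with $r\mid m_{ri}$ for every $i\ge 1$. By convention $p_r(0)=p_r'(0)=1$. *)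

(* Defs.v *)
From HB Require Import structures.
From mathcomp Require Import all_boot all_fingroup.
Set Implicit Arguments. Unset Strict Implicit. Unset Printing Implicit Defensive.
Import GroupScope.

(* Elements: pairs (f, pi), f : {1..n} -> G (here 'I_n -> gT), pi in S_n.
   Paper: (f,pi)(f',pi') = (f * f'_pi, pi pi') with f'_pi(i) = f'(pi^-1 i),
   where pi pi' is composition "pi after pi'".  In mathcomp, (s * t) x = t (s x),
   so the paper's pi pi' is the mathcomp permutation pi' * pi. *)

Definition wreath_type (gT : finGroupType) (n : nat) :=
  ({ffun 'I_n -> gT} * 'S_n)%type.

HB.instance Definition _ gT n :=
  Finite.copy (wreath_type gT n) ({ffun 'I_n -> gT} * 'S_n)%type.

Section Wreath.
Variables (gT : finGroupType) (n : nat).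
Local Notation W := ({ffun 'I_n -> gT} * 'S_n)%type.

Definition wr_mul (x y : W) : W :=
  ([ffun i => x.1 i * y.1 ((x.2)^-1 i)], y.2 * x.2).
Definition wr_one : W := ([ffun _ => 1], 1).
Definition wr_inv (x : W) : W := ([ffun i => (x.1 (x.2 i))^-1], (x.2)^-1).

Lemma wr_mulA : associative wr_mul.
Proof.
move=> [f p] [g q] [h t]; rewrite /wr_mul /=; apply: f_equal2; last by rewrite mulgA.
by apply/ffunP=> i; rewrite !ffunE mulgA invMg permM.
Qed.

Lemma wr_mul1 : left_id wr_one wr_mul.
Proof.
move=> [f p]; rewrite /wr_mul /wr_one /=; apply: f_equal2; last by rewrite mulg1.
by apply/ffunP=> i; rewrite !ffunE mul1g invg1 perm1.
Qed.

Lemma wr_mulV : left_inverse wr_one wr_inv wr_mul.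
Proof.
move=> [f p]; rewrite /wr_mul /wr_one /=; apply: f_equal2; last by rewrite mulgV.
by apply/ffunP=> i; rewrite !ffunE invgK mulVg.
Qed.

End Wreath.

HB.instance Definition _ gT n :=
  Finite_isGroup.Build (wreath_type gT n)
    (@wr_mulA gT n) (@wr_mul1 gT n) (@wr_mulV gT n).

Notation "G \wr_S n" := (wreath_type G n) (at level 40).

Definition rth_power_class (gT : finGroupType) (r : nat) (C : {set gT}) :=
  C \subset [set x ^+ r | x in [set: gT]].

Definition CC_r (gT : finGroupType) (r : nat) : nat :=
  #|[set C in classes [set: gT] | rth_power_class r C]|.

(* A partition of n is encoded by its multiplicities: m i = m_{i+1} is the
   number of parts equal to i+1 (parts range over 1..n), with
   sum_{j=1}^n j * m_j = n. *)
Definition partition_mults (n : nat) :=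
  [set m : {ffun 'I_n -> 'I_n.+1} | \sum_(i < n) (i.+1 * m i) == n].

Definition p_r (r n : nat) : nat :=
  #|[set m in partition_mults n | [forall i : 'I_n, r %| m i]]|.

Definition p_r' (r n : nat) : nat :=
  #|[set m in partition_mults n | [forall i : 'I_n, (r %| i.+1) ==> (r %| m i)]]|.

(* Main.v *)
(** A point [i] of ['I_n] is coloured, relative to [x = (f, pi)], by the length of its [pi]-cycle and
    the conjugacy class in [G] of the product of [f] along that cycle.  The numbers of cycles of each
    colour [(k, C)] classify [x] up to conjugacy.  For [r] prime, the [r]-th power map keeps a cycle of
    colour [(k, C)] whole with colour [(k, C^r)] if [r] does not divide [k], and breaks it into [r]
    cycles of colour [(k / r, C)] otherwise.  Hence the multiplicities of an [r]-th power at [(k, C)]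
    are divisible by [r] as soon as [r] divides [k] or [C] is not an [r]-th power, and these are the
    only constraints: listing the classes with the [d] non-[r]-th powers first, the first [d] rows of
    multiplicities are counted by [p_r] and the others by [p_r']. *)

Require Import Defs.
From HB Require Import structures.
From mathcomp Require Import all_boot all_fingroup.
Set Implicit Arguments. Unset Strict Implicit. Unset Printing Implicit Defensive.
Import GroupScope.

(** * Cocycles, cycle products and colours of points *)

Section Cocycle.
Variables (gT : finGroupType) (n : nat).
Implicit Types (x y z : gT \wr_S n) (i j : 'I_n).

(* [x] acts on ['I_n * gT] by [(i, a) |-> (x.2 i, cocycle x i * a)], commuting with right translations. *)
Definition cocycle x i : gT := x.1 (x.2 i).

Lemma wr_perm1 i : (1 : gT \wr_S n).2 i = i.
Proof. by rewrite /= perm1. Qed.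

Lemma wr_permM x y i : (x * y).2 i = x.2 (y.2 i).
Proof. by rewrite /= permM. Qed.

Lemma wr_permX x k i : (x ^+ k).2 i = iter k x.2 i.
Proof. by elim: k => [|k IHk]; rewrite ?wr_perm1 // expgS wr_permM IHk. Qed.

Lemma cocycle1 i : cocycle 1 i = 1.
Proof. by rewrite /cocycle /= ffunE. Qed.

Lemma cocycleM x y i : cocycle (x * y) i = cocycle x (y.2 i) * cocycle y i.
Proof. by rewrite /cocycle wr_permM /= ffunE permK. Qed.

Lemma cocycleX_fixed x k i :
  x.2 i = i -> cocycle (x ^+ k) i = cocycle x i ^+ k.
Proof.
move=> fix_i; elim: k => [|k IHk]; first by rewrite cocycle1.
by rewrite expgSr cocycleM fix_i IHk -expgSr.
Qed.

Lemma wr_ext x y :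
  (forall i, x.2 i = y.2 i) -> (forall i, cocycle x i = cocycle y i) -> x = y.
Proof.
case: x y => [f p] [g q] /= eq_pq eq_fg.
have {}eq_pq: p = q by apply/permP.
subst q; congr (_, _); apply/ffunP => i.
by have := eq_fg (p^-1 i); rewrite /cocycle /= permKV.
Qed.

Lemma wr_of_cocycle (s : 'I_n -> 'I_n) (h : 'I_n -> gT) :
  injective s ->
  exists z, (forall i, z.2 i = s i) /\ (forall i, cocycle z i = h i).
Proof.
move=> s_inj; pose p := perm s_inj.
exists ([ffun i => h (p^-1 i)], p); rewrite /cocycle /=.
by split=> i; rewrite ?ffunE ?permK // permE.
Qed.

Definition cycle_len x i := fingraph.order x.2 i.

Lemma cycle_len_gt0 x i : 0 < cycle_len x i.
Proof. exact: fingraph.order_gt0. Qed.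

Lemma cycle_len_le x i : cycle_len x i <= n.
Proof. by rewrite -[n in X in _ <= X]card_ord; apply: max_card. Qed.

Lemma wr_permX_fixed x k i : ((x ^+ k).2 i == i) = (cycle_len x i %| k).
Proof.
have injx: injective x.2 by apply: perm_inj.
have fixq q : iter (q * cycle_len x i) x.2 i = i.
  by elim: q => // q IHq; rewrite mulSn iterD IHq iter_order.
rewrite wr_permX (divn_eq k (cycle_len x i)) addnC iterD fixq.
rewrite dvdn_addl ?dvdn_mull //.
have lt_kl := ltn_pmod k (cycle_len_gt0 x i).
apply/eqP/idP => [fix_i | dvd_l]; last first.
  by rewrite /dvdn modn_mod in dvd_l; rewrite (eqP dvd_l).
by have := findex_iter lt_kl; rewrite fix_i findex0 => <-.
Qed.

Lemma wr_permX_eq x t u i :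
  ((x ^+ t).2 i == (x ^+ u).2 i) = (t == u %[mod cycle_len x i]).
Proof.
wlog le_ut: t u / u <= t => [IH|].
  by have [/IH//|/ltnW/IH] := leqP u t; rewrite eq_sym => ->; rewrite eq_sym.
rewrite eqn_mod_dvd // -wr_permX_fixed -[in LHS](subnKC le_ut) expgD wr_permM.
by rewrite inj_eq //; apply: perm_inj.
Qed.

Lemma cycle_len_unique x i m :
  (forall k, ((x ^+ k).2 i == i) = (m %| k)) -> cycle_len x i = m.
Proof.
move=> fixm; apply/eqP; rewrite eqn_dvd -wr_permX_fixed fixm dvdnn /=.
by rewrite -fixm wr_permX_fixed.
Qed.

Lemma wr_perm_len x i : (x ^+ cycle_len x i).2 i = i.
Proof. by apply/eqP; rewrite wr_permX_fixed. Qed.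

(** The product of [x.1] once around the cycle through [i]. Moving the starting point along the
    cycle conjugates it, which is why [colour] keeps only its class. *)
Definition cycle_product x i := cocycle (x ^+ cycle_len x i) i.

Definition colour x i := (cycle_len x i, cycle_product x i ^: [set: gT]).

Lemma classT_eqP (a b : gT) :
  reflect (exists h, h * a = b * h) (a ^: [set: gT] == b ^: [set: gT]).
Proof.
apply: (iffP eqP) => [/class_eqP/imsetP[h _ ->]|[h hab]].
  by exists h; rewrite -conjgC.
by apply/class_eqP/imsetP; exists h; rewrite ?inE // conjgE -hab mulKg.
Qed.

(** By induction [z] also intertwines [x ^+ k] with [y ^+ k], so [z.2] preserves return times.
    Comparing cocycles at the return time shows that [cocycle z i] conjugates one cycle product into
    the other. *)
Lemma colour_intertwine x y z i :
  z * x = y * z -> colour y (z.2 i) = colour x i.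
Proof.
move=> zx; have zxX k : z * x ^+ k = y ^+ k * z.
  by elim: k => [|k IHk]; rewrite ?mulg1 ?mul1g // expgSr mulgA IHk -mulgA zx mulgA -expgSr.
have len_eq: cycle_len y (z.2 i) = cycle_len x i.
  apply: cycle_len_unique => k.
  by rewrite -wr_permM -zxX wr_permM inj_eq ?wr_permX_fixed //; apply: perm_inj.
rewrite /colour /cycle_product len_eq; congr (_, _); apply/esym/eqP/classT_eqP.
exists (cocycle z i); rewrite -[RHS]cocycleM -zxX cocycleM.
by rewrite wr_perm_len.
Qed.

Lemma colourX x k i : colour x ((x ^+ k).2 i) = colour x i.
Proof. by apply: colour_intertwine; rewrite -expgS -expgSr. Qed.

Definition colour_count x c := #|[set i | colour x i == c]|.

Definition cycle_count x c := #|[set i in froots x.2 | colour x i == c]|.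

(** By [colourX] the colour is constant along cycles, so the points of colour [(k, C)] form whole
    cycles of [k] points each. *)
Lemma colour_countE x k C :
  colour_count x (k, C) = (k * cycle_count x (k, C))%N.
Proof.
rewrite /colour_count /cycle_count mulnC.
rewrite -(@fcard_order_set _ _ (@perm_inj _ x.2) k [set i | colour x i == (k, C)]).
- congr (_ * _)%N; apply: eq_card => i; rewrite !inE.
  by rewrite andbC.
- by apply/subsetP => i; rewrite !inE => /eqP[<- _]; apply/eqP.
- move=> i j /eqP <-; rewrite !inE.
  by have := colourX x 1 i; rewrite expg1 => ->.
Qed.

Lemma colour_count_intertwine x y z c :
  z * x = y * z -> colour_count x c = colour_count y c.
Proof.
move=> zx; rewrite /colour_count -(card_imset _ (@perm_inj _ z.2)).
apply: eq_card => j; rewrite !inE; apply/imsetP/eqP => [[i]|<-].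
  by rewrite inE => /eqP <- ->; apply: colour_intertwine.
exists (z.2^-1 j); rewrite ?permKV // inE.
by rewrite -(colour_intertwine _ zx) permKV.
Qed.

End Cocycle.

(** * Equal colour counts imply conjugacy *)

Lemma fiber_bijection (T : finType) (K : eqType) (A B : {pred T}) (a b : T -> K) :
  (forall c, #|[pred i in A | a i == c]| = #|[pred i in B | b i == c]|) ->
  exists beta : T -> T,
    [/\ {in A, forall i, beta i \in B}, {in A, forall i, b (beta i) = a i}
      & {in A &, injective beta}].
Proof.
move=> eqAB; pose sA c := enum [pred i in A | a i == c].
pose sB c := enum [pred i in B | b i == c].
have size_s c : size (sA c) = size (sB c) by rewrite -!cardE eqAB.
(* Each fibre of [a] is matched rank by rank with the fibre of [b] over the same value; equal sizes
   keep the default of [nth] from being used on [A]. *)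
pose beta i := nth i (sB (a i)) (index i (sA (a i))).
have idx i : i \in A -> index i (sA (a i)) < size (sB (a i)).
  by move=> Ai; rewrite -size_s index_mem mem_enum inE Ai /=.
have beta_in i : i \in A -> beta i \in sB (a i) by move=> /idx/mem_nth->.
exists beta; split=> [i /beta_in|i /beta_in|i j Ai Aj eq_ij].
- by rewrite mem_enum => /andP[].
- by rewrite mem_enum => /andP[_ /eqP].
have eq_a: a i = a j.
  have := beta_in _ Aj; have := beta_in _ Ai; rewrite eq_ij !mem_enum !inE.
  by case/andP=> _ /eqP-> /andP[_ /eqP].
have lt_j := idx _ Aj; have := idx _ Ai; rewrite eq_a => lt_i.
move/eqP: eq_ij; rewrite /beta eq_a (set_nth_default j) //.
rewrite nth_uniq ?enum_uniq // => /eqP eq_idx.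
have Sj: j \in sA (a j) by rewrite mem_enum inE Aj /=.
have Si: i \in sA (a j) by rewrite mem_enum inE Ai /= eq_a.
by rewrite -(nth_index i Si) eq_idx nth_index.
Qed.

Section Conjugacy.
Variables (gT : finGroupType) (n : nat).
Implicit Types (x y z : gT \wr_S n) (i j : 'I_n).

Lemma cycle_count_eq x y :
  (forall c, colour_count x c = colour_count y c) ->
  forall c, cycle_count x c = cycle_count y c.
Proof.
move=> eq_xy [[|k] C]; last first.
  by apply/eqP; rewrite -(eqn_pmul2l (ltn0Sn k)) -!colour_countE eq_xy.
(* Length 0 cannot be cancelled in [colour_countE], but no cycle has it. *)
have cc0 u : cycle_count u (0, C) = 0.
  apply: eq_card0 => i; rewrite !inE andbC xpair_eqE.
  by rewrite eqn0Ngt cycle_len_gt0.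
by rewrite !cc0.
Qed.

(** Cycles of equal colour are matched through their roots, a conjugator of the cycle products is
    chosen at each root, and [z] is propagated along the cycles by the required relation. *)
Lemma colour_count_conj x y :
  (forall c, colour_count x c = colour_count y c) -> exists z, z * x = y * z.
Proof.
move=> eq_xy; have injP (u : 'S_n) : injective u by apply: perm_inj.
have [|beta [beta_root beta_col beta_inj]] :=
    @fiber_bijection _ _ (froots x.2) (froots y.2) (colour x) (colour y).
  move=> c; have := cycle_count_eq eq_xy c; rewrite /cycle_count !cardsE => eq_c.
  by rewrite -[LHS]/(#|_|) eq_c.
have /fin_all_exists[h hP] r : exists h, r \in froots x.2 ->
    h * cycle_product x r = cycle_product y (beta r) * h.
  have [rx|] := boolP (r \in froots x.2); last by exists 1.
  have [_ /esym/eqP/classT_eqP[h hP]] := beta_col r rx.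
  by exists h.
have len_beta r : r \in froots x.2 -> cycle_len y (beta r) = cycle_len x r.
  by case/beta_col.
pose root_of i := froot x.2 i; pose t_of i := findex x.2 (root_of i) i.
have rootx i : root_of i \in froots x.2.
  by apply/eqP/root_root; apply: fconnect_sym; apply: injP.
have root_t i : (x ^+ t_of i).2 (root_of i) = i.
  rewrite wr_permX iter_findex // (fconnect_sym (@injP _)) connect_root //.
have root_iter t r : r \in froots x.2 -> root_of ((x ^+ t).2 r) = r.
  move=> rx; have rootr: root_of r = r by apply/eqP.
  rewrite -{2}rootr; apply/esym/rootP.
    exact/fconnect_sym/injP.
  by rewrite wr_permX fconnect_iter.
(* The relation forces [z = y ^+ t * z * (x ^+ t)^-1]. The permutation and the cocycle of the right
   side at the point [(x ^+ t).2 r] are [zeta t r] and [hh t r]. *)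
pose zeta t r := (y ^+ t).2 (beta r).
pose hh t r := cocycle (y ^+ t) (beta r) * h r * (cocycle (x ^+ t) r)^-1.
(* The value at [x^t r] does not depend on [t], as [h r] conjugates the cycle products. *)
have wd t u r : r \in froots x.2 -> (x ^+ t).2 r = (x ^+ u).2 r ->
    zeta t r = zeta u r /\ hh t r = hh u r.
  wlog le_tu : t u / t <= u.
    move=> IH rx eq_tu; have [/IH|/ltnW/IH] := leqP t u; first exact.
    by case/(_ rx (esym eq_tu)).
  move=> rx; rewrite -(subnKC le_tu) expgD wr_permM => /perm_inj/esym/eqP.
  rewrite wr_permX_fixed => /dvdnP[q ->].
  have fixx: (x ^+ (q * cycle_len x r)).2 r = r.
    by apply/eqP; rewrite wr_permX_fixed dvdn_mull.
  have fixy: (y ^+ (q * cycle_len x r)).2 (beta r) = beta r.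
    by apply/eqP; rewrite wr_permX_fixed len_beta // dvdn_mull.
  rewrite /zeta /hh !expgD wr_permM !cocycleM fixx fixy; split=> //.
  (* Over [q] full turns the cocycles are the [q]-th powers of the cycle products, so [hP] can be
     iterated. *)
  have hq: h r * cocycle (x ^+ (q * cycle_len x r)) r
         = cocycle (y ^+ (q * cycle_len x r)) (beta r) * h r.
    have fixl: (y ^+ cycle_len x r).2 (beta r) = beta r.
      by rewrite -(len_beta r rx) wr_perm_len.
    rewrite mulnC !expgM (cocycleX_fixed _ (wr_perm_len x r)) (cocycleX_fixed _ fixl).
    have := hP r rx; rewrite /cycle_product len_beta // => hr.
    elim: q {fixx fixy} => [|q IHq]; rewrite ?mulg1 ?mul1g //.
    by rewrite [in LHS]expgSr mulgA IHq -(mulgA _ (h r)) hr mulgA -expgSr.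
  rewrite invMg -!mulgA; congr (_ * _).
  by rewrite [RHS]mulgA -hq -!mulgA mulKVg.
(* Different roots go to different cycles of [y], since [beta] is injective with values in the
   roots; within one cycle the lengths for [x] and [y] agree. *)
have zeta_inj : injective (fun i => zeta (t_of i) (root_of i)).
  move=> i j eq_ij; have ri := rootx i; have rj := rootx j.
  have eq_r : root_of i = root_of j.
    apply: beta_inj => //; have /eqP := beta_root _ ri; have /eqP := beta_root _ rj.
    move=> <- <-; apply/rootP; first exact/fconnect_sym/injP.
    rewrite (connect_trans (y := zeta (t_of i) (root_of i))) //.
      by rewrite /zeta wr_permX fconnect_iter.
    by rewrite eq_ij /zeta (fconnect_sym (@injP _)) wr_permX fconnect_iter.
  rewrite -(root_t i) -(root_t j) -eq_r; apply/eqP; rewrite wr_permX_eq.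
  by rewrite -len_beta // -wr_permX_eq; apply/eqP; rewrite [LHS]eq_ij /zeta -eq_r.
have [z [z2 zc]] := wr_of_cocycle (fun i => hh (t_of i) (root_of i)) zeta_inj.
(* [wd] replaces the exponent [t_of] by any [t], so that passing to [t.+1] below needs no
   wrap-around case. *)
have z2E t r : r \in froots x.2 -> z.2 ((x ^+ t).2 r) = zeta t r.
  by move=> rx; rewrite z2 root_iter // (wd _ t r rx _).1 // -{2}(root_iter t r rx) root_t.
have zcE t r : r \in froots x.2 -> cocycle z ((x ^+ t).2 r) = hh t r.
  by move=> rx; rewrite zc root_iter // (wd _ t r rx _).2 // -{2}(root_iter t r rx) root_t.
exists z; apply: wr_ext => i; rewrite -(root_t i); set r := root_of i; set t := t_of i.
  by rewrite !wr_permM -(wr_permM x) -expgS !z2E ?rootx // /zeta expgS wr_permM.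
rewrite !cocycleM -(wr_permM x) -expgS z2E ?rootx // !zcE ?rootx // /hh /zeta.
by rewrite !expgS !cocycleM invMg !mulgA mulgKV.
Qed.
End Conjugacy.

(** * The effect of the [r]-th power map on colours *)

Lemma rth_power_classP (gT : finGroupType) (r : nat) (a : gT) :
  reflect (exists b, a = b ^+ r) (rth_power_class r (a ^: [set: gT])).
Proof.
apply: (iffP subsetP) => [/(_ a (class_refl _ _))/imsetP[b _ ->]|[b ->] _ /imsetP[h _ ->]].
  by exists b.
by apply/imsetP; exists (b ^ h); rewrite ?inE // conjXg.
Qed.

(** Makes the choice of [repr] in [colour_pow] harmless. *)
Lemma classX_repr (gT : finGroupType) (a : gT) k :
  (repr (a ^: [set: gT]) ^+ k) ^: [set: gT] = (a ^+ k) ^: [set: gT].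
Proof.
have [h _ ->] := repr_class [set: gT] a.
by rewrite -conjXg classGidl ?inE.
Qed.

Section Powers.
Variables (gT : finGroupType) (r : nat).
Hypothesis r_prime : prime r.

(* The colour of a point for [x ^+ r] in terms of its colour for [x]: the [r]-th power breaks a
   cycle of length divisible by [r] into [r] cycles, and otherwise raises its product to the [r]. *)
Definition colour_pow (c : nat * {set gT}) : nat * {set gT} :=
  if r %| c.1 then (c.1 %/ r, c.2) else (c.1, (repr c.2 ^+ r) ^: [set: gT]).

(** If [r] divides the length [l], the first return of [x ^+ r] takes [l %/ r] steps and is again
    [x ^+ l]. Otherwise primality makes [r] coprime to [l], the return takes [l] steps, and
    [cocycleX_fixed] gives the [r]-th power of the product. *)
Lemma colour_expr n (x : gT \wr_S n) i : colour (x ^+ r) i = colour_pow (colour x i).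
Proof.
rewrite /colour_pow /=; case: ifPn => r_l.
  have len_r: cycle_len (x ^+ r) i = cycle_len x i %/ r.
    apply: cycle_len_unique => k; rewrite -expgM wr_permX_fixed.
    by rewrite -{1}(divnK r_l) mulnC dvdn_pmul2l ?prime_gt0.
  by rewrite /colour /cycle_product len_r -expgM mulnC divnK.
have len_r: cycle_len (x ^+ r) i = cycle_len x i.
  apply: cycle_len_unique => k; rewrite -expgM wr_permX_fixed.
  by rewrite Gauss_dvdr // coprime_sym prime_coprime.
rewrite /colour /cycle_product len_r classX_repr -expgM mulnC expgM.
by rewrite (cocycleX_fixed _ (wr_perm_len x i)).
Qed.

(** Under this hypothesis the colour [(k, C)] arises only by splitting: a cycle kept whole has
    length prime to [r] and yields an [r]-th power class. The points counted are thus those of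
    colour [(r * k, C)] for [x]. *)
Lemma colour_count_expr_dvd n (x : gT \wr_S n) k C :
  (r %| k) || ~~ rth_power_class r C -> r * k %| colour_count (x ^+ r) (k, C).
Proof.
move=> rkC; rewrite (_ : colour_count _ _ = colour_count x ((r * k)%N, C)).
  by rewrite colour_countE dvdn_mulr.
apply: eq_card => i; rewrite !inE colour_expr.
case def_c: (colour x i) => [l D]; rewrite /colour_pow /= !xpair_eqE.
case: ifPn => rl.
  by rewrite xpair_eqE -(eqn_pmul2l (prime_gt0 r_prime)) [(r * (_ %/ _))%N]mulnC divnK.
have l_neq m : (l == r * m)%N = false.
  by apply: contraNF rl => /eqP->; rewrite dvdn_mulr.
rewrite !xpair_eqE l_neq /=; case: (l =P k) rkC => //= <-.
rewrite (negPf rl) /= => nC; apply: contraNF nC => /eqP<-.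
by apply/rth_power_classP; exists (repr D).
Qed.

End Powers.

(** * Realising prescribed cycles *)

Section Realisation.
Variables (gT : finGroupType) (n : nat) (I : finType) (len : I -> nat) (g : I -> gT).
Hypotheses (len_gt0 : forall c, 0 < len c) (sum_len : \sum_c len c = n).

(** Points are pairs of a cycle [c] and a residue modulo [len c]. The permutation adds 1 to the
    residue, and the cocycle is [g c] at residue 0 and trivial elsewhere, so that one turn has
    product [g c]. *)
Lemma wr_of_cycles :
  exists (x : gT \wr_S n) (q : 'I_n -> I),
    (forall i, colour x i = (len (q i), g (q i) ^: [set: gT]))
    /\ (forall c, #|[set i | q i == c]| = len c).
Proof.
pose T := {c : I & 'I_(len c)}.
have cardT : #|{: T}| = n.
  rewrite card_tagged sumnE big_map big_enum -sum_len.
  by apply: eq_bigr => c _; rewrite card_ord.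
pose e (i : 'I_n) : T := enum_val (cast_ord (esym cardT) i).
pose e' (t : T) : 'I_n := cast_ord cardT (enum_rank t).
have eK : cancel e e' by move=> i; rewrite /e' /e enum_valK cast_ordKV.
have e'K : cancel e' e by move=> t; rewrite /e' /e cast_ordK enum_rankK.
pose pt c t : 'I_n := e' (Tagged (fun c => 'I_(len c)) (Ordinal (ltn_pmod t (len_gt0 c)))).
have ptE i : exists t, i = pt (tag (e i)) t.
  exists (tagged (e i)); rewrite -[LHS]eK; congr e'.
  case: (e i) => c j /=; congr Tagged; apply: val_inj.
  by rewrite /= modn_small.
have tag_pt c t : tag (e (pt c t)) = c by rewrite e'K.
have pt_eq c t u : (pt c t == pt c u) = (t == u %[mod len c]).
  by rewrite (can_eq e'K) eq_Tagged -val_eqE.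
pose s i := pt (tag (e i)) (tagged (e i)).+1.
have s_pt c t : s (pt c t) = pt c t.+1.
  by rewrite /s e'K /=; apply/eqP; rewrite pt_eq /= -addn1 modnDml addn1.
have s_inj : injective s.
  move=> i j; have [t ->] := ptE i; have [u ->] := ptE j; rewrite !s_pt => eq_s.
  have := congr1 (fun k => tag (e k)) eq_s; rewrite !tag_pt => eq_c.
  move/eqP: eq_s; rewrite eq_c pt_eq -addn1 -[u.+1]addn1 eqn_modDr => eq_tu.
  by apply/eqP; rewrite pt_eq.
pose h i := if i == pt (tag (e i)) 0 then g (tag (e i)) else 1.
have [x [x2 xc]] := wr_of_cocycle h s_inj.
have x2X c k t : (x ^+ k).2 (pt c t) = pt c (t + k).
  elim: k => [|k IHk]; first by rewrite wr_perm1 addn0.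
  by rewrite expgS wr_permM IHk x2 s_pt addnS.
have lenE c t : cycle_len x (pt c t) = len c.
  by apply: cycle_len_unique => k; rewrite x2X pt_eq -{2}[t]addn0 eqn_modDl mod0n.
(* The bound on [k] stops before residue 0 is left a second time, which would bring in another
   factor [g c]. *)
have cX c k : 0 < k <= len c -> cocycle (x ^+ k) (pt c 0) = g c.
  elim: k => [//|[|k] IHk] /andP[_ le_k].
    by rewrite expg1 xc /h tag_pt eqxx.
  rewrite expgS cocycleM IHk ?(ltnW le_k) // xc x2X /h tag_pt pt_eq mod0n add0n.
  by rewrite modn_small // mul1g.
exists x, (fun i => tag (e i)); split=> [i|c].
  have [t ->] := ptE i; rewrite tag_pt; set c := tag _.
  rewrite -[t]add0n -x2X colourX /colour /cycle_product lenE cX //.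
  by rewrite len_gt0 leqnn.
rewrite -[RHS]card_ord -[RHS]cardsT.
rewrite -(card_imset _ (_ : injective (fun j : 'I_(len c) => pt c j))).
  apply: eq_card => i; rewrite inE; apply/eqP/imsetP => [<-|[j _ ->]]; last exact: tag_pt.
  by exists (tagged (e i)); rewrite ?inE // -[LHS]eK; congr e'; case: (e i) => c' j /=;
    congr Tagged; apply: val_inj; rewrite /= modn_small.
move=> j k /eqP; rewrite pt_eq !modn_small // => /eqP; exact: val_inj.
Qed.

End Realisation.

(** * Counting families of multiplicity vectors *)

Lemma enum_prefix (T : finType) (A : {set T}) (P : pred T) :
  exists f : 'I_#|A| -> T,
    [/\ injective f, forall i, f i \in A, {in A, forall c, exists i, c = f i}
      & forall i, P (f i) = (i < #|[set x in A | P x]|)].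
Proof.
(* Listing the elements that satisfy [P] first turns [P (f i)] into a bound on [i]. *)
pose l1 := enum [set x in A | P x]; pose l := l1 ++ enum [set x in A | ~~ P x].
have size1 : size l1 = #|[set x in A | P x]| by rewrite cardE.
have size_l : size l = #|A|.
  rewrite size_cat -!cardE -(cardsID [set x | P x] A).
  by congr addn; apply: eq_card => x; rewrite !inE 1?andbC.
have mem_l x : (x \in l) = (x \in A).
  by rewrite mem_cat !mem_enum !inE -andb_orr orbN andbT.
have uniq_l : uniq l.
  rewrite cat_uniq !enum_uniq andbT /=; apply/hasPn => x.
  by rewrite !mem_enum !inE => /andP[_ /negPf->]; rewrite andbF.
pose f (i : 'I_#|A|) := tnth (in_tuple l) (cast_ord (esym size_l) i).
have fE x0 i : f i = nth x0 l i by rewrite /f (tnth_nth x0).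
exists f; split=> [i j|i|c|i].
- rewrite (fE (f i) i) (fE (f i) j) => /eqP; rewrite nth_uniq ?size_l // => /eqP.
  exact: val_inj.
- by rewrite -mem_l (fE (f i)) mem_nth ?size_l.
- rewrite -mem_l => lc; have ltc: index c l < #|A| by rewrite -size_l index_mem.
  by exists (Ordinal ltc); rewrite (fE c) nth_index.
rewrite (fE (f i)) nth_cat size1; move: (f i) => x0; case: ltnP => [lt_i|ge_i].
  have: nth x0 l1 i \in l1 by rewrite mem_nth ?size1.
  by rewrite mem_enum inE => /andP[].
set l2 := enum _; have: nth x0 l2 (i - #|[set x in A | P x]|) \in l2.
  by rewrite mem_nth // ltn_subLR // -size1 -size_cat size_l.
by rewrite mem_enum inE => /andP[_ /negPf].
Qed.

Section Padding.
Variables (t n : nat) (P : nat -> nat -> bool).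
Hypotheses (le_tn : t <= n) (P0 : forall k, P k 0).

(** The size of the partition encoded by [f]: index [k] stands for parts of size [k.+1]. *)
Definition mults_weight m (f : {ffun 'I_m -> 'I_m.+1}) := \sum_(k < m) k.+1 * f k.

Lemma mults_weight_ge m (f : {ffun 'I_m -> 'I_m.+1}) (k : 'I_m) : k.+1 * f k <= mults_weight f.
Proof. by rewrite /mults_weight (bigD1 k) //= leq_addr. Qed.

(** [p_r] and [p_r'] at [t] use vectors of length [t], cycle types the common length [n]. Weight [t]
    forces entries at most [t] and no parts larger than [t], so extension by zero is a bijection;
    [P0] handles the added entries. *)
Lemma card_mults_pad :
  #|[set f : {ffun 'I_t -> 'I_t.+1} |
      (mults_weight f == t) && [forall k : 'I_t, P k.+1 (f k)]]|
  = #|[set f : {ffun 'I_n -> 'I_n.+1} |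
      (mults_weight f == t) && [forall k : 'I_n, P k.+1 (f k)]]|.
Proof.
pose ext (f : {ffun 'I_t -> 'I_t.+1}) : {ffun 'I_n -> 'I_n.+1} :=
  [ffun k : 'I_n => if insub (k : nat) is Some j then inord (f j) else ord0].
have extE f j : ext f (widen_ord le_tn j) = f j :> nat.
  rewrite ffunE /= valK inordK //.
  by rewrite ltnS (leq_trans _ le_tn) // -ltnS.
have ext0 f (k : 'I_n) : t <= k -> ext f k = ord0.
  by rewrite ffunE leqNgt; case: insubP => // j ->.
have ext_inj : injective ext.
  move=> f g eq_fg; apply/ffunP => j; apply: val_inj.
  by rewrite -[LHS]extE -[RHS]extE eq_fg.
have wE (F : {ffun 'I_n -> 'I_n.+1}) : (forall k : 'I_n, t <= k -> F k = ord0) ->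
    mults_weight F = \sum_(j < t) j.+1 * F (widen_ord le_tn j).
  move=> F0; rewrite /mults_weight (bigID (fun k : 'I_n => k < t)) /=.
  rewrite [X in (_ + X)%N]big1 ?addn0.
    by rewrite (big_ord_narrow le_tn).
  by move=> k; rewrite -leqNgt => /F0->; rewrite muln0.
rewrite -(card_imset _ ext_inj); apply: eq_card => F; rewrite !inE.
apply/imsetP/andP => [[f]|[/eqP wF /forallP PF]].
  rewrite inE => /andP[/eqP wf /forallP Pf] ->; split.
    rewrite wE; last exact: ext0.
    by under eq_bigr do rewrite extE; apply/eqP.
  apply/forallP => k; have [lt_kt|le_tk] := ltnP k t; last by rewrite ext0.
  by have := Pf (Ordinal lt_kt); rewrite -extE; congr (P _ (ext f _)); apply: val_inj.
have F0 (k : 'I_n) : t <= k -> F k = ord0.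
  move=> le_tk; apply/val_inj/eqP; rewrite -leqn0 leqNgt /=; apply/negP => Fk.
  have := mults_weight_ge F k; rewrite wF leqNgt => /negP[].
  by rewrite (leq_ltn_trans le_tk) // -[k in k < _]/(k : nat) leq_pmulr.
pose f : {ffun 'I_t -> 'I_t.+1} := [ffun j => inord (F (widen_ord le_tn j))].
have fE j : f j = F (widen_ord le_tn j) :> nat.
  rewrite ffunE inordK // ltnS -[X in _ <= X]wF.
  by rewrite (leq_trans _ (mults_weight_ge F (widen_ord le_tn j))) // leq_pmull.
exists f.
  rewrite inE; apply/andP; split.
    by rewrite -[X in _ == X]wF wE // /mults_weight; under eq_bigr do rewrite fE.
  by apply/forallP => j; rewrite fE; apply: PF (widen_ord le_tn j).
apply/ffunP => k; apply: val_inj; have [lt_kt|le_tk] := ltnP k t; last first.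
  by rewrite F0 // ext0.
have -> : k = widen_ord le_tn (Ordinal lt_kt) by apply: val_inj.
by rewrite /= extE fE.
Qed.

End Padding.

Section FamilyCount.
Variables (s n : nat) (Q : 'I_s -> pred {ffun 'I_n -> 'I_n.+1}).

(** Families are sorted by their vector of row weights; once the weights are fixed, the rows are
    chosen independently. *)
Lemma card_mults_families :
  #|[set F : {ffun 'I_s -> {ffun 'I_n -> 'I_n.+1}} |
      (\sum_i mults_weight (F i) == n) && [forall i, Q i (F i)]]|
  = \sum_(t : {ffun 'I_s -> 'I_n.+1} | \sum_(i < s) (t i : nat) == n)
      \prod_(i < s) #|[set f | (mults_weight f == t i) && Q i f]|.
Proof.
pose wt (F : {ffun 'I_s -> {ffun 'I_n -> 'I_n.+1}}) : {ffun 'I_s -> 'I_n.+1} :=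
  [ffun i => inord (mults_weight (F i))].
(* [inord] is faithful here because no row outweighs the total [n]. *)
have wtE (F : {ffun 'I_s -> {ffun 'I_n -> 'I_n.+1}}) i : \sum_i mults_weight (F i) == n -> wt F i = mults_weight (F i) :> nat.
  move=> /eqP sumF; rewrite ffunE inordK // ltnS -[X in _ <= X]sumF.
  by rewrite (bigD1 i) //= leq_addr.
rewrite -sum1_card (partition_big wt (fun t => \sum_(i < s) (t i : nat) == n)) /=; last first.
  by move=> F; rewrite inE => /andP[sumF _]; under eq_bigr do rewrite wtE //.
apply: eq_bigr => t /eqP sum_t; rewrite sum1_card.
transitivity #|family (fun i => [set f | (mults_weight f == t i) && Q i f])|; last first.
  by rewrite card_family foldrE big_map big_enum.
apply: eq_card => F; rewrite unfold_in inE; apply/andP/familyP => [[/andP[sumF /forallP QF] /eqP<-] i|memF].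
  by rewrite inE wtE // eqxx QF.
have wF i : mults_weight (F i) = t i by have := memF i; rewrite inE => /andP[/eqP].
have sumF : \sum_i mults_weight (F i) == n by rewrite -[X in _ == X]sum_t; under eq_bigr do rewrite wF.
split; last by apply/eqP/ffunP => i; apply: val_inj; rewrite /= wtE.
rewrite sumF; apply/forallP => i; by have := memF i; rewrite inE => /andP[].
Qed.

End FamilyCount.

(** * Cycle types of [r]-th powers and the final count *)

Section Types.
Variables (gT : finGroupType) (r n s d : nat) (Cl : 'I_s -> {set gT}).
Hypotheses (r_prime : prime r) (Cl_inj : injective Cl).
Hypotheses (Cl_class : forall i, Cl i \in classes [set: gT]).
Hypotheses (Cl_onto : {in classes [set: gT], forall C, exists i, C = Cl i}).
Hypotheses (Cl_pow : forall i, ~~ rth_power_class r (Cl i) = (i < d)).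
Implicit Types (x y : gT \wr_S n) (F : {ffun 'I_s -> {ffun 'I_n -> 'I_n.+1}}).

Let idx_colour (p : 'I_s * 'I_n) : nat * {set gT} := (p.2.+1, Cl p.1).

Lemma colour_idx x j : exists p, colour x j = idx_colour p.
Proof.
have [|i defC] := Cl_onto (_ : cycle_product x j ^: [set: gT] \in _).
  by apply: imset_f; rewrite inE.
have lt_l : (cycle_len x j).-1 < n by rewrite prednK ?cycle_len_gt0 ?cycle_len_le.
by exists (i, Ordinal lt_l); rewrite /colour /idx_colour /= defC prednK ?cycle_len_gt0.
Qed.

Lemma idx_colour_inj : injective idx_colour.
Proof. by move=> [i k] [i' k'] [/val_inj-> /Cl_inj->]. Qed.

(** The matrix of cycle multiplicities, with rows for classes and columns for lengths; at most [n]
    cycles exist, so [inord] loses nothing. *)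
Definition wr_type x : {ffun 'I_s -> {ffun 'I_n -> 'I_n.+1}} :=
  [ffun i => [ffun k : 'I_n => inord (cycle_count x (k.+1, Cl i))]].

Lemma wr_typeE x i k : wr_type x i k = cycle_count x (k.+1, Cl i) :> nat.
Proof.
by rewrite !ffunE inordK // ltnS -[n in X in _ <= X]card_ord; apply: max_card.
Qed.

(** Both sides count the points of ['I_n], the left one colour by colour. *)
Lemma wr_type_weight x : \sum_i mults_weight (wr_type x i) = n.
Proof.
have /fin_all_exists[p pP] := colour_idx x.
rewrite -[RHS]card_ord -sum1_card (partition_big p predT) //=.
rewrite pair_bigA /=; apply: eq_bigr => q _.
rewrite wr_typeE -colour_countE sum1_card; apply: eq_card => j.
by rewrite !inE pP -[X in _ == X]/(idx_colour q) (inj_eq idx_colour_inj).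
Qed.

Lemma wr_type_conj x y : wr_type x = wr_type y -> exists z, z * x = y * z.
Proof.
move=> eq_xy; apply: colour_count_conj => c.
have [p /eqP->|np] := pickP (fun p => c == idx_colour p).
  by rewrite !colour_countE -!wr_typeE eq_xy.
have cc0 (u : gT \wr_S n) : colour_count u c = 0.
  apply: eq_card0 => j; rewrite !inE; have [p ->] := colour_idx u j.
  by rewrite eq_sym np.
by rewrite !cc0.
Qed.

(** For [i < d] this is the condition of [p_r], for the other rows that of [p_r']. *)
Definition power_type (i : nat) : pred {ffun 'I_n -> 'I_n.+1} :=
  fun f => [forall k : 'I_n, (i < d) || (r %| k.+1) ==> (r %| f k)].

Lemma wr_type_expr x (i : 'I_s) : power_type i (wr_type (x ^+ r) i).
Proof.
apply/forallP => k; apply/implyP => bad_ik; rewrite wr_typeE.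
rewrite -(@dvdn_pmul2l k.+1) // -colour_countE mulnC.
by rewrite colour_count_expr_dvd // Cl_pow orbC.
Qed.

(* A root is assembled cycle by cycle: [r] cycles of length [k] and class [C] come from one cycle
   of length [r * k] and class [C]; when this is not forced, a single one comes from a cycle of
   length [k] whose product is an [r]-th root of an element of [C]. *)
Lemma wr_type_expr_onto F :
  \sum_i mults_weight (F i) = n -> (forall i : 'I_s, power_type i (F i)) ->
  exists x, wr_type (x ^+ r) = F.
Proof.
move=> sumF powF; pose bad (p : 'I_s * 'I_n) := (p.1 < d) || (r %| p.2.+1).
have powF' p : bad p -> r %| F p.1 p.2.
  by have /forallP/(_ p.2)/implyP := powF p.1.
have /fin_all_exists[b bP] (i : 'I_s) : exists a, ~~ (i < d) -> Cl i = (a ^+ r) ^: [set: gT].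
  have /imsetP[a _ defC] := Cl_class i.
  have [//|pow_a] := boolP (i < d); first by exists 1.
  move: pow_a; rewrite -Cl_pow negbK defC => /rth_power_classP[c ->].
  by exists c.
pose cnt p := if bad p then F p.1 p.2 %/ r else F p.1 p.2.
pose len p := if bad p then (r * p.2.+1)%N else p.2.+1.
pose g (p : 'I_s * 'I_n) := if bad p then repr (Cl p.1) else b p.1.
(* The regrouping keeps the number of points per colour, so the lengths still add up to [n] as
   [wr_of_cycles] requires. *)
have cnt_len p : (cnt p * len p = p.2.+1 * F p.1 p.2)%N.
  rewrite /cnt /len; case: ifPn => bad_p; last by rewrite mulnC.
  by rewrite mulnA divnK ?powF' // mulnC.
pose I := {p : 'I_s * 'I_n & 'I_(cnt p)}.
have sumI (P : pred ('I_s * 'I_n)) :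
    \sum_(c : I | P (tag c)) len (tag c) = \sum_(p | P p) p.2.+1 * F p.1 p.2.
  transitivity (\sum_(p | P p) \sum_(j < cnt p) len p).
    by rewrite sig_big_dep; apply: eq_bigl => c; rewrite andbT.
  by apply: eq_bigr => p _; rewrite sum_nat_const card_ord cnt_len.
have len_gt0 (c : I) : 0 < len (tag c).
  by rewrite /len; case: ifP => // _; rewrite muln_gt0 prime_gt0.
have sum_len : \sum_(c : I) len (tag c) = n.
  by rewrite (sumI predT) -[RHS]sumF pair_bigA.
have [x [q [col_x card_q]]] := wr_of_cycles (fun c => g (tag c)) len_gt0 sum_len.
have pow_len p : colour_pow r (len p, g p ^: [set: gT]) = idx_colour p.
  rewrite /len /g /colour_pow /idx_colour; have [bad_p|bad_p] /= := boolP (bad p).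
    rewrite dvdn_mulr // mulKn ?prime_gt0 //; congr (_, _).
    have /imsetP[a _ ->] := Cl_class p.1.
    by have := classX_repr a 1; rewrite !expg1.
  move: bad_p; rewrite negb_or => /andP[pd /negPf->].
  by rewrite classX_repr -bP.
exists x; apply/ffunP => i; apply/ffunP => k; apply: val_inj; apply/eqP.
rewrite /= wr_typeE -(eqn_pmul2l (ltn0Sn k)) -colour_countE.
have := sumI (pred1 (i, k)); rewrite big_pred1_eq /= => <-.
rewrite /colour_count -sum1_card (partition_big q (fun c => tag c == (i, k))) /=; last first.
  move=> j; rewrite inE colour_expr // col_x pow_len -[X in _ == X]/(idx_colour (i, k)).
  by rewrite (inj_eq idx_colour_inj).
apply/eqP/eq_bigr => c /eqP tag_c; rewrite sum1_card -card_q; apply: eq_card => j.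
rewrite unfold_in !inE colour_expr // col_x pow_len -[X in _ == X]/(idx_colour (i, k)).
by rewrite (inj_eq idx_colour_inj) andb_idl // => /eqP->; rewrite tag_c.
Qed.

(** Elements of equal type are conjugate, so the type of a representative separates classes;
    [wr_type_expr] and [wr_type_expr_onto] identify its image on the [r]-th power classes. *)
Lemma CC_r_types :
  CC_r (gT \wr_S n) r =
  #|[set F : {ffun 'I_s -> {ffun 'I_n -> 'I_n.+1}} |
      (\sum_i mults_weight (F i) == n) && [forall i : 'I_s, power_type i (F i)]]|.
Proof.
have class_repr (X : {set gT \wr_S n}) :
    X \in classes [set: gT \wr_S n] -> X = repr X ^: [set: gT \wr_S n].
  move=> /imsetP[x _ ->]; have [h _ ->] := repr_class [set: gT \wr_S n] x.
  by rewrite classGidl ?inE.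
rewrite /CC_r -(@card_in_imset _ _ (fun X => wr_type (repr X))).
  apply: eq_card => F; rewrite inE; apply/imsetP/andP => [[X]|[/eqP sumF /forallP powF]].
    rewrite inE => /andP[/class_repr-> /rth_power_classP[y ->]].
    have [h _ ->] := repr_class [set: gT \wr_S n] (y ^+ r).
    rewrite conjXg => ->; rewrite wr_type_weight; split=> //.
    by apply/forallP => i; apply: wr_type_expr.
  have [y defF] := wr_type_expr_onto sumF powF.
  exists ((y ^+ r) ^: [set: gT \wr_S n]).
    rewrite inE; apply/andP; split; first by apply: imset_f; rewrite inE.
    by apply/rth_power_classP; exists y.
  have [h _ ->] := repr_class [set: gT \wr_S n] (y ^+ r).
  rewrite -{}defF; apply/ffunP => i; apply/ffunP => k; rewrite !ffunE; congr inord.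
  apply: cycle_count_eq => c; apply/esym/(colour_count_intertwine (z := h)).
  exact/esym/conjgC.
move=> X Y; rewrite !inE => /andP[clX _] /andP[clY _] /wr_type_conj eqXY.
by rewrite (class_repr X) // (class_repr Y) //; apply/eqP/classT_eqP.
Qed.

End Types.

Theorem theorem5p9 (gT : finGroupType) (r n : nat) (hr : prime r) :
  let s := #|classes [set: gT]| in
  let d := #|[set C in classes [set: gT] | ~~ rth_power_class r C]| in
  CC_r (gT \wr_S n) r =
  \sum_(t : {ffun 'I_s -> 'I_n.+1} | \sum_(i < s) (t i : nat) == n)
     \prod_(i < s) (if (i < d)%N then p_r r (t i) else p_r' r (t i)).
Proof.
move=> s d.
have [Cl [Cl_inj Cl_class Cl_onto Cl_pow]] :=
  enum_prefix (classes [set: gT]) (fun C => ~~ rth_power_class r C).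
rewrite (CC_r_types n hr Cl_inj Cl_class Cl_onto Cl_pow) (card_mults_families (fun i : 'I_s => @power_type r n d i)).
apply: eq_bigr => t _; apply: eq_bigr => i _.
have le_tn : t i <= n by rewrite -ltnS.
(* One condition covers both kinds of rows, so the vectors shrink from length [n] to [t i] before
   the test [i < d] separates [p_r] from [p_r']. *)
rewrite -(card_mults_pad (P := fun j m => (i < d) || (r %| j) ==> (r %| m)) le_tn); last first.
  by move=> k; rewrite dvdn0 implybT.
case: ifP => _; apply: eq_card => f; rewrite !inE //=.
Qed.
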